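(* The indefinite octonionic projective plane $\mathbb OP^{(1,1)}$ (with the metric below) is a special Osserman manifold.
   Context: Octonions $\mathbb O=\mathbb H\oplus\mathbb H$ with product $(q_1,q_2)(p_1,p_2)=(q_1p_1-\bar p_2q_2,\ p_2q_1+q_2\bar p_1)$, conjugation $\overline{(q_1,q_2)}=(\bar q_1,-q_2)$, $\langle a,b\rangle=\mathrm{Re}(a\bar b)$, $|a|^2=\langle a,a\rangle$. $\mathbb OP^{(1,1)}=(U_1\cup U_2)/_\sim$ with $U_1=\{(1,u,v):1+|u|^2-|v|^2>0\}$, $U_2=\{(u,1,v):|u|^2+1-|v|^2>0\}$, $[a,b,c]\sim[d,e,f]$ iff $(a,b,c)=(d\lambda,e\lambda,f\lambda)$ for some $\lambda\ne0$; charts $[1,u,v]\mapsto(u,v)$, $[u,1,v]\mapsto(u,v)$; metric of signature $(8,8)$ on each chart, for tangent vector $(du,dv)=(\xi,\eta)$: $ds^2=\frac{|\xi|^2(1-|v|^2)-|\eta|^2(1+|u|^2)+2\mathrm{Re}[(u\bar v)(\eta\bar\xi)]}{(1+|u|^2-|v|^2)^2}$. For a semi-Riemannian manifold with curvature $(1,3)$-tensor $R$ (convention: $g(R(X,Y)Z,W)=R(X,Y,Z,W)$ where in coordinates with vanishing first metric derivatives $R_{\alpha\beta\gamma\delta}=\tfrac12[\partial_\alpha\partial_\delta g_{\beta\gamma}+\partial_\beta\partial_\gamma g_{\alpha\delta}-\partial_\beta\partial_\delta g_{\alpha\gamma}-\partial_\alpha\partial_\gamma g_{\beta\delta}]$),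 the Jacobi operator is $\mathcal J_v(x)=R(v,x)v$. For unit $v$ ($\varepsilon_v:=g(v,v)=\pm1$), the manifold is special Osserman if there are real numbers $\lambda\ne\mu$, both nonzero, such that at every point and for every unit $v$: (I) $\mathcal J_v|_{v^\perp}$ is diagonalizable with exactly the two nonzero eigenvalues $\varepsilon_v\lambda,\varepsilon_v\mu$; (II) with $E_\lambda(v)=\mathrm{span}\{v\}\oplus\ker(\mathcal J_v-\varepsilon_v\lambda\mathrm{Id})$, every unit $w\in E_\lambda(v)$ has $E_\lambda(w)=E_\lambda(v)$; (III) if $w$ is unit and $w\in\ker(\mathcal J_v-\varepsilon_v\mu\mathrm{Id})$ then $v\in\ker(\mathcal J_w-\varepsilon_w\mu\mathrm{Id})$. *)

(* Defs.v *)
From HB Require Import structures.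
From mathcomp Require Import all_boot all_order all_algebra.
From mathcomp Require Import all_classical all_reals all_analysis.
Set Implicit Arguments.
Unset Strict Implicit.
Unset Printing Implicit Defensive.
Import Order.TTheory GRing.Theory Num.Theory.
Local Open Scope ring_scope.

Section Octonions.
Variable R : realType.

Record quat := Quat { qre : R; qi : R; qj : R; qk : R }.

Definition qadd (p q : quat) : quat :=
  Quat (qre p + qre q) (qi p + qi q) (qj p + qj q) (qk p + qk q).
Definition qopp (p : quat) : quat := Quat (- qre p) (- qi p) (- qj p) (- qk p).
Definition qsub (p q : quat) : quat := qadd p (qopp q).
Definition qconj (p : quat) : quat := Quat (qre p) (- qi p) (- qj p) (- qk p).
Definition qmul (p q : quat) : quat :=
  Quat (qre p * qre q - qi p * qi q - qj p * qj q - qk p * qk q)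
       (qre p * qi q + qi p * qre q + qj p * qk q - qk p * qj q)
       (qre p * qj q - qi p * qk q + qj p * qre q + qk p * qi q)
       (qre p * qk q + qi p * qj q - qj p * qi q + qk p * qre q).

Record oct := Oct { o1 : quat; o2 : quat }.

Definition omul (a b : oct) : oct :=
  Oct (qsub (qmul (o1 a) (o1 b)) (qmul (qconj (o2 b)) (o2 a)))
      (qadd (qmul (o2 b) (o1 a)) (qmul (o2 a) (qconj (o1 b)))).
Definition oconj (a : oct) : oct := Oct (qconj (o1 a)) (qopp (o2 a)).
Definition ore (a : oct) : R := qre (o1 a).
Definition oinner (a b : oct) : R := ore (omul a (oconj b)).
Definition onorm2 (a : oct) : R := oinner a a.

Definition crd (x : 'rV[R]_16) (k : nat) : R := x ord0 (inord k).
Definition oct_at (x : 'rV[R]_16) (k : nat) : oct :=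
  Oct (Quat (crd x k) (crd x (k + 1)%N) (crd x (k + 2)%N) (crd x (k + 3)%N))
      (Quat (crd x (k + 4)%N) (crd x (k + 5)%N) (crd x (k + 6)%N) (crd x (k + 7)%N)).
Definition cu (x : 'rV[R]_16) : oct := oct_at x 0.
Definition cv (x : 'rV[R]_16) : oct := oct_at x 8.

(* chart images: [1,u,v] in U1 iff 1+|u|^2-|v|^2 > 0 ;
                 [u,1,v] in U2 iff |u|^2+1-|v|^2 > 0 *)
Definition U1_dom (x : 'rV[R]_16) : Prop :=
  0 < 1 + onorm2 (cu x) - onorm2 (cv x).
Definition U2_dom (x : 'rV[R]_16) : Prop :=
  0 < onorm2 (cu x) + 1 - onorm2 (cv x).

Definition OP11_quad (x X : 'rV[R]_16) : R :=
  let u := cu x in let v := cv x in let xi := cu X in let eta := cv X in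
  (onorm2 xi * (1 - onorm2 v) - onorm2 eta * (1 + onorm2 u)
   + 2 * ore (omul (omul u (oconj v)) (omul eta (oconj xi))))
  / (1 + onorm2 u - onorm2 v) ^+ 2.

Definition OP11_metric (x X Y : 'rV[R]_16) : R :=
  (OP11_quad x (X + Y) - OP11_quad x X - OP11_quad x Y) / 2.

Variable n : nat.

Definition evec (i : 'I_n) : 'rV[R]_n := delta_mx ord0 i.

Definition pd (i : 'I_n) (f : 'rV[R]_n -> R) (x : 'rV[R]_n) : R :=
  'D_(evec i) f x.

Definition gmx (g : 'rV[R]_n -> 'rV[R]_n -> 'rV[R]_n -> R) (x : 'rV[R]_n)
  : 'M[R]_n := \matrix_(i, j) g x (evec i) (evec j).

Definition christoffel (g : 'rV[R]_n -> 'rV[R]_n -> 'rV[R]_n -> R)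
  (k i j : 'I_n) (x : 'rV[R]_n) : R :=
  2^-1 * \sum_(l < n) (invmx (gmx g x)) k l *
     (pd i (fun y => gmx g y j l) x + pd j (fun y => gmx g y i l) x
      - pd l (fun y => gmx g y i j) x).

(* Components R^d_{abc} of the curvature (1,3)-tensor with the paper's sign
   convention:  R(d_a,d_b)d_c = sum_d R^d_{abc} d_d, where
   R(X,Y) = nabla_Y nabla_X - nabla_X nabla_Y + nabla_[X,Y]
   (the negative of  [nabla_X,nabla_Y] - nabla_[X,Y]).  With this convention
   g(R(d_a,d_b)d_c,d_d) equals, in coordinates with vanishing first metric
   derivatives,  1/2[d_a d_d g_bc + d_b d_c g_ad - d_b d_d g_ac - d_a d_c g_bd]. *)
Definition curv_comp (g : 'rV[R]_n -> 'rV[R]_n -> 'rV[R]_n -> R)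
  (d a b c : 'I_n) (x : 'rV[R]_n) : R :=
  pd b (christoffel g d a c) x - pd a (christoffel g d b c) x
  + \sum_(e < n) (christoffel g e a c x * christoffel g d b e x
                  - christoffel g e b c x * christoffel g d a e x).

Definition curv (g : 'rV[R]_n -> 'rV[R]_n -> 'rV[R]_n -> R)
  (x X Y Z : 'rV[R]_n) : 'rV[R]_n :=
  \row_(d < n) \sum_(a < n) \sum_(b < n) \sum_(c < n)
     X ord0 a * Y ord0 b * Z ord0 c * curv_comp g d a b c x.

Definition jacobi (g : 'rV[R]_n -> 'rV[R]_n -> 'rV[R]_n -> R)
  (x v w : 'rV[R]_n) : 'rV[R]_n := curv g x v w v.

Section SO.
Variable g : 'rV[R]_n -> 'rV[R]_n -> 'rV[R]_n -> R.

Definition unit_vec (x v : 'rV[R]_n) : Prop :=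
  g x v v = 1 \/ g x v v = -1.
Definition epsv (x v : 'rV[R]_n) : R := g x v v.

Definition in_eig (x v : 'rV[R]_n) (c : R) (w : 'rV[R]_n) : Prop :=
  jacobi g x v w = (epsv x v * c) *: w.

Definition Espace (x v : 'rV[R]_n) (c : R) (w : 'rV[R]_n) : Prop :=
  exists (t : R) (y : 'rV[R]_n), w = t *: v + y /\ in_eig x v c y.

Definition orth (x v w : 'rV[R]_n) : Prop := g x v w = 0.

(* (I) J_v restricted to v^perp is diagonalizable with exactly the two
   eigenvalues eps_v lam and eps_v mu *)
Definition cond_I (x v : 'rV[R]_n) (lam mu : R) : Prop :=
  (forall w, orth x v w ->
     exists a b, orth x v a /\ orth x v b /\ in_eig x v lam a /\
                 in_eig x v mu b /\ w = a + b)
  /\ (exists a, a != 0 /\ orth x v a /\ in_eig x v lam a)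
  /\ (exists b, b != 0 /\ orth x v b /\ in_eig x v mu b).

Definition cond_II (x v : 'rV[R]_n) (lam : R) : Prop :=
  forall w, unit_vec x w -> Espace x v lam w ->
    forall z, Espace x w lam z <-> Espace x v lam z.

Definition cond_III (x v : 'rV[R]_n) (mu : R) : Prop :=
  forall w, unit_vec x w -> in_eig x v mu w -> in_eig x w mu v.

Definition special_osserman (D : 'rV[R]_n -> Prop) : Prop :=
  exists lam mu : R, lam != mu /\ lam != 0 /\ mu != 0 /\
    forall x, D x -> forall v, unit_vec x v ->
      cond_I x v lam mu /\ cond_II x v lam /\ cond_III x v mu.
End SO.

End Octonions.

(* Main.v *)
(* Write <x,y> for the form |u|^2 - |v|^2 of signature (8,8) on O^2.  The
   Clifford algebra of R^{1,8} = R + O acts on O^2 by self-adjoint operators, and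
   its moment map yields a trilinear product T(x,y,z) for which T(x,y,.) is a
   Clifford multiplication and T(x,y,z) + T(y,z,x) + T(z,x,y) =
   <x,y>z + <y,z>x + <z,x>y (Fierz identity).  Everything follows from these two
   facts.  With {X,y,Z} = 2<X,y>Z + 2<y,Z>X - <X,Z>y - T(X,Z,y), a Jordan triple
   product, D = 1 + <x,x> and B Y = (<x,x>Y + T(x,x,Y))/2, the metric at x is
   <GX,Y> with G = (D - B)/D^2, its Christoffel tensor is -{X,x,Y}/D, and the
   Jordan identity turns the Jacobi operator into {X,GX,Y} - {X,GY,X}.  The
   self-adjoint root L of G satisfies L{X,LY,Z} = {LX,Y,LZ}, so L transports the
   Jacobi operator at x to the one at the origin,
   Y |-> 5/2 <X,X>Y - 4<X,Y>X + 3/2 T(X,X,Y).  Since T(X,X,.)^2 = <X,X>^2, its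
   eigenvalues on the complement of X are 4<X,X> and <X,X>; conditions II and III
   come from <X,X>T(Y,Y,.) = +-<Y,Y>T(X,X,.) for Y in the two eigenspaces. *)
From HB Require Import structures.
Require Import Defs.
From mathcomp Require Import all_boot all_order all_algebra.
From mathcomp Require Import all_classical all_reals all_analysis.
From mathcomp Require Import ring lra.
Set Implicit Arguments.
Unset Strict Implicit.
Unset Printing Implicit Defensive.
Import Order.TTheory GRing.Theory Num.Theory.
Import numFieldNormedType.Exports.
Local Open Scope ring_scope.

(** * Curvature from an explicit Christoffel tensor *)

Section Curvature.
Local Open Scope classical_set_scope.
Variables (R : realType) (n : nat).
Notation V := 'rV[R]_n.
Implicit Types (f : V -> R) (g : V -> V -> V -> R) (x v X Y Z : V).

(** Everything differentiated below is at most quadratic along lines, or a quotient of such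
    functions, so derivatives are read off as linear coefficients. *)
Lemma is_derive_quadratic f x v (a b : R) :
  (forall h, f (h *: v + x) = f x + h * a + h ^+ 2 * b) -> is_derive x v f a.
Proof.
move=> fE.
suff cvg_f : (fun h => h^-1 *: ((f \o shift x) (h *: v) - f x)) @ 0^' --> a.
  by apply: DeriveDef; [apply/cvg_ex; exists a | exact: cvg_lim cvg_f].
apply: (@cvg_trans _ ((fun h : R => a + h * b) @ 0^')).
  apply: near_eq_cvg; near=> h.
  have nzh : h != 0 by near: h; exact: nbhs_dnbhs_neq.
  by rewrite /= fE /GRing.scale /=; field.
have : (fun h : R => a + h * b) @ (0 : R) --> a + 0 * b.
  by apply: cvgD; [exact: cvg_cst | apply: cvgM; [exact: cvg_id | exact: cvg_cst]].
by rewrite mul0r addr0; exact: cvg_within_filter.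
Unshelve. all: by end_near. Qed.

Lemma is_derive_quot (f h : V -> R) x v (df dh : R) : h x != 0 ->
  is_derive x v f df -> is_derive x v h dh ->
  is_derive x v (fun y => f y / h y) ((df * h x - f x * dh) / h x ^+ 2).
Proof.
move=> nzh [drf <-] [drh <-].
have drV := derivableV nzh drh.
apply: DeriveDef; first exact: derivableM.
rewrite (deriveM drf drV) (deriveV nzh drh) /GRing.scale /=.
by field.
Qed.

Lemma linear_evecE f : (forall a X Y, f (a *: X + Y) = a * f X + f Y) ->
  forall X, f X = \sum_i X 0 i * f (evec R i).
Proof.
move=> flin X.
have f0 : f 0 = 0 by have := flin 1 0 0; rewrite scale1r addr0; lra.
have fD Y Z : f (Y + Z) = f Y + f Z by rewrite -[Y]scale1r flin scale1r mul1r.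
rewrite {1}(row_sum_delta X) (big_morph f fD f0); apply: eq_bigr => i _.
by have := flin (X 0 i) (delta_mx 0 i) 0; rewrite addr0 f0 addr0.
Qed.

(** Lowering the index of [W] gives the Christoffel symbols of the first kind, so [invmx] cancels
    and is never computed. *)
Lemma christoffelE g x (W : V) k i j :
  gmx g x \in unitmx -> (gmx g x)^T = gmx g x ->
  (forall l, 2 * (W *m gmx g x) 0 l =
     pd i (fun y => gmx g y j l) x + pd j (fun y => gmx g y i l) x
     - pd l (fun y => gmx g y i j) x) ->
  christoffel g k i j x = W 0 k.
Proof.
move=> Gunit Gsym WE; rewrite /christoffel.
under eq_bigr do rewrite -WE mulrCA.
rewrite -mulr_sumr mulKf ?pnatr_eq0 //.
have -> : W 0 k = (W *m gmx g x *m invmx (gmx g x)) 0 k by rewrite mulmxK.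
rewrite [RHS]mxE; apply: eq_bigr => l _; rewrite mulrC; congr (_ * _).
by rewrite -{1}Gsym -trmx_inv mxE.
Qed.

(** Both sides are trilinear and agree on basis vectors. The Christoffel tensor is given near [x]
    because its components get differentiated. *)
Lemma curvE g x (G : V -> V -> V -> V) (dG : V -> V -> V -> V) :
  (\forall y \near x, forall k i j,
     christoffel g k i j y = G y (evec R i) (evec R j) 0 k) ->
  (forall k l i j, is_derive x (evec R l) (fun y => G y (evec R i) (evec R j) 0 k)
     (dG (evec R l) (evec R i) (evec R j) 0 k)) ->
  (forall a X X' Y, G x (a *: X + X') Y = a *: G x X Y + G x X' Y) ->
  (forall a X Y Y', G x X (a *: Y + Y') = a *: G x X Y + G x X Y') ->
  (forall a X X' Y Z, dG (a *: X + X') Y Z = a *: dG X Y Z + dG X' Y Z) ->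
  (forall a X Y Y' Z, dG X (a *: Y + Y') Z = a *: dG X Y Z + dG X Y' Z) ->
  (forall a X Y Z Z', dG X Y (a *: Z + Z') = a *: dG X Y Z + dG X Y Z') ->
  forall X Y Z, curv g x X Y Z =
    dG Y X Z - dG X Y Z + (G x Y (G x X Z) - G x X (G x Y Z)).
Proof.
move=> GE dGE Gl Gr dGl dGm dGr X Y Z; apply/rowP => d.
pose F X Y Z := (dG Y X Z - dG X Y Z + (G x Y (G x X Z) - G x X (G x Y Z))) 0 d.
have GxE := nbhs_singleton GE.
have curv_compE a b c :
    curv_comp g d a b c x = F (evec R a) (evec R b) (evec R c).
  have pdE l i j : pd l (christoffel g d i j) x =
      dG (evec R l) (evec R i) (evec R j) 0 d.
    rewrite /pd -[RHS](@derive_val _ _ _ _ _ _ _ (dGE d l i j)).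
    by apply: near_eq_derive; apply: filterS GE => y; apply.
  rewrite /curv_comp !pdE /F !mxE; congr (_ + _).
  have GG i j l : \sum_e christoffel g e i l x * christoffel g d j e x =
      G x (evec R j) (G x (evec R i) (evec R l)) 0 d.
    rewrite (@linear_evecE (fun W => G x (evec R j) W 0 d)); last first.
      by move=> s W W'; rewrite Gr !mxE.
    by apply: eq_bigr => e _; rewrite !GxE.
  by rewrite big_split /= sumrN !GG.
rewrite mxE -[RHS]/(F X Y Z).
have Fl a X1 X2 Y1 Z1 : F (a *: X1 + X2) Y1 Z1 = a * F X1 Y1 Z1 + F X2 Y1 Z1.
  by rewrite /F !(dGl, dGm, Gl, Gr) !mxE; ring.
have Fm a X1 X2 Y1 Z1 : F Y1 (a *: X1 + X2) Z1 = a * F Y1 X1 Z1 + F Y1 X2 Z1.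
  by rewrite /F !(dGl, dGm, Gl, Gr) !mxE; ring.
have Fr a X1 X2 Y1 Z1 : F Y1 Z1 (a *: X1 + X2) = a * F Y1 Z1 X1 + F Y1 Z1 X2.
  by rewrite /F !(dGr, Gr) !mxE; ring.
rewrite (linear_evecE (f := fun W => F W Y Z)) //; apply: eq_bigr => a _.
rewrite (linear_evecE (f := fun W => F _ W Z)) // mulr_sumr; apply: eq_bigr => b _.
rewrite (linear_evecE (f := fun W => F _ _ W)) // !mulr_sumr; apply: eq_bigr => c _.
by rewrite curv_compE !mulrA.
Qed.

End Curvature.

(** * The Clifford action on pairs of octonions *)

Section Definitions.
Variable R : realType.
Notation V := 'rV[R]_16.
Implicit Types (x y z : V) (p q c : oct R).

Definition octpair p q : V :=
  \row_i nth 0 [:: qre (o1 p); qi (o1 p); qj (o1 p); qk (o1 p);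
                   qre (o2 p); qi (o2 p); qj (o2 p); qk (o2 p);
                   qre (o1 q); qi (o1 q); qj (o1 q); qk (o1 q);
                   qre (o2 q); qi (o2 q); qj (o2 q); qk (o2 q)] i.

Definition oadd p q : oct R := Oct (qadd (o1 p) (o1 q)) (qadd (o2 p) (o2 q)).
Definition qscale a (s : quat R) :=
  Quat (a * qre s) (a * qi s) (a * qj s) (a * qk s).
Definition oscale a p := Oct (qscale a (o1 p)) (qscale a (o2 p)).

Definition ip x y := oinner (cu x) (cu y) - oinner (cv x) (cv y).

(* The square of [cliff r c] is [r ^+ 2 - |c|^2]: signature (1,8). *)
Definition cliff r c z := octpair
  (oadd (oscale r (cu z)) (oscale (-1) (omul c (cv z))))
  (oadd (omul (oconj c) (cu z)) (oscale (- r) (cv z))).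

(* The moment map of the action, see [cliff_ip]. *)
Definition beta0 x y := oinner (cu x) (cu y) + oinner (cv x) (cv y).
Definition beta1 x y := oadd (omul (cu x) (oconj (cv y)))
                             (omul (cu y) (oconj (cv x))).

(* The product T of the introduction. *)
Definition tp x y z := cliff (beta0 x y) (beta1 x y) z.

End Definitions.

(* The next operators are locked because a failed comparison of two of their
   values would otherwise unfold down to the 16 coordinates. *)

(* The Jordan triple product {X, y, Z}. *)
HB.lock Definition jt (R : realType) (X y Z : 'rV[R]_16) : 'rV[R]_16 :=
  (2 * ip X y) *: Z + (2 * ip y Z) *: X - ip X Z *: y - tp X Z y.

(* [ip x x] times the projection onto the octonionic line through [x]. *)
HB.lock Definition bop (R : realType) (x Y : 'rV[R]_16) : 'rV[R]_16 :=
  2^-1 *: (ip x x *: Y + tp x x Y).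

Definition den (R : realType) (x : 'rV[R]_16) := 1 + ip x x.

(* The metric at [x], as an operator self-adjoint for [ip]. *)
HB.lock Definition gop (R : realType) (x Y : 'rV[R]_16) : 'rV[R]_16 :=
  (den x)^-1 *: Y - (den x) ^- 2 *: bop x Y.

(* The square root of [gop x]: it is [s^-1] times the identity off the line of
   [x] and [s ^- 2] on it. *)
HB.lock Definition rop (R : realType) (x Y : 'rV[R]_16) : 'rV[R]_16 :=
  let s := Num.sqrt (den x) in s^-1 *: Y + - (s ^+ 2 * (1 + s))^-1 *: bop x Y.

Section Plane.
Variable R : realType.
Notation V := 'rV[R]_16.
Implicit Types (x y z w v X Y Z : V) (p q : oct R).

Lemma crd_octpair p q k : (k < 16)%N -> crd (octpair p q) k =
  nth 0 [:: qre (o1 p); qi (o1 p); qj (o1 p); qk (o1 p);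
            qre (o2 p); qi (o2 p); qj (o2 p); qk (o2 p);
            qre (o1 q); qi (o1 q); qj (o1 q); qk (o1 q);
            qre (o2 q); qi (o2 q); qj (o2 q); qk (o2 q)] k.
Proof. by move=> lt_k; rewrite /crd mxE inordK. Qed.

Lemma cu_octpair p q : cu (octpair p q) = p.
Proof.
by case: p => [[? ? ? ?] [? ? ? ?]]; rewrite /cu /oct_at !crd_octpair.
Qed.

Lemma cv_octpair p q : cv (octpair p q) = q.
Proof.
by case: q => [[? ? ? ?] [? ? ? ?]]; rewrite /cv /oct_at !crd_octpair.
Qed.

Lemma octpairK x : octpair (cu x) (cv x) = x.
Proof.
apply/rowP => i; rewrite mxE -[in RHS](inord_val i) -/(crd x i).
by case: i => k; do 16?[case: k => [|k] //=].
Qed.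

(** Writing vectors as [octpair p q] leaves polynomial identities in free real variables, within
    reach of [ring]. *)
Lemma octpair_ind (P : V -> Prop) :
  (forall p q, P (octpair p q)) -> forall x, P x.
Proof. by move=> Poct x; rewrite -(octpairK x). Qed.

Lemma octpairD p q p' q' :
  octpair p q + octpair p' q' = octpair (oadd p p') (oadd q q').
Proof.
by apply/rowP => -[k ltk]; rewrite !mxE /=; do 16?[case: k ltk => [|k] ltk //=].
Qed.

Lemma octpairZ a p q : a *: octpair p q = octpair (oscale a p) (oscale a q).
Proof.
by apply/rowP => -[k ltk]; rewrite !mxE /=; do 16?[case: k ltk => [|k] ltk //=].
Qed.

(* [cbv] rather than [simpl]: evaluating the nested products by name duplicates
   the unreduced factors exponentially. *)
Ltac oct_ring :=
  rewrite /tp /ip /beta0 /beta1 /cliff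
    ?(cu_octpair, cv_octpair, octpairD, octpairZ);
  repeat match goal with p : oct _ |- _ =>
    destruct p as [[? ? ? ?] [? ? ? ?]] end;
  cbv [oinner ore omul oconj oadd oscale qmul qadd qsub qopp qconj qscale
       Defs.o1 Defs.o2 Defs.qre Defs.qi Defs.qj Defs.qk];
  match goal with
  | |- octpair _ _ = octpair _ _ =>
    congr (octpair (Oct (Quat _ _ _ _) (Quat _ _ _ _))
                   (Oct (Quat _ _ _ _) (Quat _ _ _ _))); ring
  | |- _ => ring
  end.

Lemma ipC x y : ip x y = ip y x.
Proof. by elim/octpair_ind: x => p q; elim/octpair_ind: y => p' q'; oct_ring. Qed.

Lemma ipDl x y z : ip (x + y) z = ip x z + ip y z.
Proof.
by elim/octpair_ind: x => p q; elim/octpair_ind: y => p' q';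
  elim/octpair_ind: z => p2 q2; oct_ring.
Qed.

Lemma ipZl a x y : ip (a *: x) y = a * ip x y.
Proof. by elim/octpair_ind: x => p q; elim/octpair_ind: y => p' q'; oct_ring. Qed.

Lemma cliff_ip r c x y : ip (cliff r c x) y = r * beta0 x y - oinner c (beta1 x y).
Proof. by elim/octpair_ind: x => p q; elim/octpair_ind: y => p' q'; oct_ring. Qed.

Lemma cliffD r c x y : cliff r c (x + y) = cliff r c x + cliff r c y.
Proof. by elim/octpair_ind: x => p q; elim/octpair_ind: y => p' q'; oct_ring. Qed.

Lemma cliffZ r c a x : cliff r c (a *: x) = a *: cliff r c x.
Proof. by elim/octpair_ind: x => p q; oct_ring. Qed.

(** Polarized alternativity, in the form $c(\bar c z) = |c|^2 z$. *)
Lemma cliff_anticomm r c r' c' z :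
  cliff r c (cliff r' c' z) + cliff r' c' (cliff r c z)
  = (2 * (r * r' - oinner c c')) *: z.
Proof. by elim/octpair_ind: z => p q; oct_ring. Qed.

Lemma tpDl x y z w : tp (x + y) z w = tp x z w + tp y z w.
Proof.
by elim/octpair_ind: x => p q; elim/octpair_ind: y => p' q';
  elim/octpair_ind: z => p2 q2; elim/octpair_ind: w => p3 q3; oct_ring.
Qed.

Lemma tpZl a x y z : tp (a *: x) y z = a *: tp x y z.
Proof.
by elim/octpair_ind: x => p q; elim/octpair_ind: y => p' q';
  elim/octpair_ind: z => p2 q2; oct_ring.
Qed.

Lemma tpC x y z : tp x y z = tp y x z.
Proof.
by elim/octpair_ind: x => p q; elim/octpair_ind: y => p' q';
  elim/octpair_ind: z => p2 q2; oct_ring.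
Qed.

Lemma tp_fierz x y z :
  tp x y z + tp y z x + tp z x y = ip x y *: z + ip y z *: x + ip z x *: y.
Proof.
by elim/octpair_ind: x => p q; elim/octpair_ind: y => p' q';
  elim/octpair_ind: z => p2 q2; oct_ring.
Qed.

Lemma beta_sym x y z w :
  beta0 x y * beta0 z w - oinner (beta1 x y) (beta1 z w)
  = beta0 z w * beta0 x y - oinner (beta1 z w) (beta1 x y).
Proof.
congr (_ - _); first by rewrite mulrC.
by move: (beta1 x y) (beta1 z w) => p q; oct_ring.
Qed.

(** Both sides are the Lorentzian product of the moments of [x, y] and of [z, w]. *)
Lemma tp_ip x y z w : ip (tp x y z) w = ip (tp z w x) y.
Proof. by rewrite /tp !cliff_ip beta_sym. Qed.

Lemma tp_anticomm x y z w u :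
  tp x y (tp z w u) + tp z w (tp x y u) = (2 * ip (tp x y z) w) *: u.
Proof. by rewrite /tp cliff_anticomm cliff_ip. Qed.

Lemma quad_tp x X : OP11_quad x X =
  ((1 + ip x x) * ip X X - (ip x x * ip X X + ip (tp x x X) X) / 2)
  / (1 + ip x x) ^+ 2.
Proof.
elim/octpair_ind: x => p q; elim/octpair_ind: X => p' q'.
rewrite /OP11_quad !(cu_octpair, cv_octpair) /onorm2.
rewrite (_ : 1 + ip _ _ = 1 + oinner p p - oinner q q); last by oct_ring.
congr (_ / _).
rewrite /tp cliff_ip /ip /beta0 /beta1 !(cu_octpair, cv_octpair).
(* [beta1 x x] is $2u\bar v$ and [beta1 X X] is $2\xi\bar\eta$, whence the factor 4; conjugation
   turns $\xi\bar\eta$ into $\eta\bar\xi$. *)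
have -> : oinner (oadd (omul p (oconj q)) (omul p (oconj q)))
    (oadd (omul p' (oconj q')) (omul p' (oconj q')))
    = 4 * ore (omul (omul p (oconj q)) (omul q' (oconj p'))).
  by oct_ring.
by field.
Qed.

Lemma ipDr x y z : ip x (y + z) = ip x y + ip x z.
Proof. by rewrite ipC ipDl !(ipC x). Qed.

Lemma ipZr a x y : ip x (a *: y) = a * ip x y.
Proof. by rewrite ipC ipZl (ipC x). Qed.

Lemma ipNl x y : ip (- x) y = - ip x y.
Proof. by rewrite -scaleN1r ipZl mulN1r. Qed.

Lemma ipNr x y : ip x (- y) = - ip x y.
Proof. by rewrite -scaleN1r ipZr mulN1r. Qed.

Lemma tpDm x y z w : tp z (x + y) w = tp z x w + tp z y w.
Proof. by rewrite tpC tpDl !(tpC z). Qed.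

Lemma tpZm a x y z : tp x (a *: y) z = a *: tp x y z.
Proof. by rewrite tpC tpZl (tpC x). Qed.

Lemma tpDr x y z w : tp x y (z + w) = tp x y z + tp x y w.
Proof. exact: cliffD. Qed.

Lemma tpZr a x y z : tp x y (a *: z) = a *: tp x y z.
Proof. exact: cliffZ. Qed.

Lemma tpNl x y z : tp (- x) y z = - tp x y z.
Proof. by rewrite -scaleN1r tpZl scaleN1r. Qed.

Lemma tpNm x y z : tp x (- y) z = - tp x y z.
Proof. by rewrite -scaleN1r tpZm scaleN1r. Qed.

Lemma tpNr x y z : tp x y (- z) = - tp x y z.
Proof. by rewrite -scaleN1r tpZr scaleN1r. Qed.

Definition ipE := (ipDl, ipDr, ipZl, ipZr, ipNl, ipNr).
Definition tpE := (tpDl, tpDm, tpDr, tpZl, tpZm, tpZr, tpNl, tpNm, tpNr).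

Lemma rowDE x y k : (x + y) 0 k = x 0 k + y 0 k. Proof. exact: mxE. Qed.
Lemma rowZE a x k : (a *: x) 0 k = a * x 0 k. Proof. exact: mxE. Qed.
Lemma rowNE x k : (- x) 0 k = - x 0 k. Proof. exact: mxE. Qed.
Definition rowE := (rowDE, rowZE, rowNE).

Ltac vec_ring := by apply/rowP => k; rewrite ?rowE; field.

Lemma tp_adj x y z w : ip (tp x y z) w = ip z (tp x y w).
Proof. by rewrite tp_ip [RHS]ipC [RHS]tp_ip (tpC z). Qed.

Lemma ip_nondeg x y : (forall z, ip x z = ip y z) -> x = y.
Proof.
have ip_delta w k : ip w (delta_mx 0 k) = (if (k < 8)%N then 1 else -1) * w 0 k.
  have crd_delta j : (j < 16)%N -> crd (delta_mx 0 k : V) j = (j == k)%:R.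
    by move=> ltj; rewrite /crd mxE eqxx -val_eqE /= inordK.
  have -> : w 0 k = crd w k by rewrite /crd inord_val.
  rewrite /ip /cu /cv /oct_at !crd_delta //.
  cbv [oinner ore omul oconj qmul qsub qadd qopp qconj
       Defs.o1 Defs.o2 Defs.qre Defs.qi Defs.qj Defs.qk].
  by case: k {crd_delta} => j; do 16?[case: j => [|j] /=; first by move=> _; ring].
move=> eq_ip; apply/rowP => k; have := eq_ip (delta_mx 0 k); rewrite !ip_delta.
by case: ifP => _; lra.
Qed.

(* The adjoint of [tp_anticomm]. *)
Lemma tp_anticomm2 x y z w u :
  tp (tp x y z) w u + tp z (tp x y w) u = (2 * ip z w) *: tp x y u.
Proof.
apply: ip_nondeg => t; rewrite !ipE.
have -> : ip (tp (tp x y z) w u) t = ip (tp u t (tp x y z)) w.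
  by rewrite tp_ip.
have -> : ip (tp z (tp x y w) u) t = ip (tp x y (tp u t z)) w.
  by rewrite tp_ip -tp_adj.
by rewrite -ipDl tp_anticomm ipZl (tp_ip u t) (ipC z); ring.
Qed.

Lemma tp_diag x : tp x x x = ip x x *: x.
Proof.
apply/rowP => k; have := congr1 (fun v : V => v 0 k) (tp_fierz x x x).
by rewrite !rowE; lra.
Qed.

(** * The Jordan triple product *)

Lemma jt_def X y Z :
  jt X y Z = (2 * ip X y) *: Z + (2 * ip y Z) *: X - ip X Z *: y - tp X Z y.
Proof. by rewrite jt.unlock. Qed.

Lemma jtC X y Z : jt X y Z = jt Z y X.
Proof. by rewrite !jt_def (tpC X Z) (ipC X y) (ipC y Z) (ipC X Z); vec_ring. Qed.

Lemma jtDl X Y y Z : jt (X + Y) y Z = jt X y Z + jt Y y Z.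
Proof. by rewrite !jt_def !(ipE, tpE); vec_ring. Qed.

Lemma jtZl a X y Z : jt (a *: X) y Z = a *: jt X y Z.
Proof. by rewrite !jt_def !(ipE, tpE); vec_ring. Qed.

Lemma jtDm X y z Z : jt X (y + z) Z = jt X y Z + jt X z Z.
Proof. by rewrite !jt_def !(ipE, tpE); vec_ring. Qed.

Lemma jtZm a X y Z : jt X (a *: y) Z = a *: jt X y Z.
Proof. by rewrite !jt_def !(ipE, tpE); vec_ring. Qed.

Lemma jtDr X Y y Z : jt Z y (X + Y) = jt Z y X + jt Z y Y.
Proof. by rewrite jtC jtDl !(jtC Z). Qed.

Lemma jtZr a X y Z : jt Z y (a *: X) = a *: jt Z y X.
Proof. by rewrite jtC jtZl !(jtC Z). Qed.

Lemma jtNl X y Z : jt (- X) y Z = - jt X y Z.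
Proof. by rewrite -scaleN1r jtZl scaleN1r. Qed.

Lemma jtNm X y Z : jt X (- y) Z = - jt X y Z.
Proof. by rewrite -scaleN1r jtZm scaleN1r. Qed.

Lemma jtNr X y Z : jt X y (- Z) = - jt X y Z.
Proof. by rewrite -scaleN1r jtZr scaleN1r. Qed.

Definition jtE := (jtDl, jtDm, jtDr, jtZl, jtZm, jtZr, jtNl, jtNm, jtNr).

(** Both forms of the Clifford anticommutation make [tp x y] a derivation, except that the middle
    slot, dual to the outer ones, carries minus its adjoint. *)
Lemma tp_jt x y X z Z :
  tp x y (jt X z Z) = jt (tp x y X) z Z - jt X (tp x y z) Z + jt X z (tp x y Z).
Proof.
have E1 : tp x y (tp X Z z) = (2 * ip (tp x y X) Z) *: z - tp X Z (tp x y z).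
  by rewrite -tp_anticomm addrK.
have E2 : tp (tp x y X) Z z = (2 * ip X Z) *: tp x y z - tp X (tp x y Z) z.
  by rewrite -tp_anticomm2 addrK.
by rewrite !jt_def !(ipE, tpE) E1 E2 -!(tp_adj x y); vec_ring.
Qed.

Lemma jt_sym X y Z : jt X y Z + jt y X Z = (3 * ip X y) *: Z + tp X y Z.
Proof.
have E : tp X y Z = ip X y *: Z + ip y Z *: X + ip Z X *: y - tp y Z X - tp Z X y.
  by rewrite -tp_fierz; vec_ring.
by rewrite !jt_def E (ipC y X) (ipC Z X) (tpC Z X); vec_ring.
Qed.

Lemma jt_diag x Z : jt x x Z = (3 / 2 * ip x x) *: Z + 2^-1 *: tp x x Z.
Proof.
apply/rowP => k; have := congr1 (fun v : V => v 0 k) (jt_sym x x Z).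
by rewrite !rowE; lra.
Qed.

Lemma jt_outer x X : jt x X x = (4 * ip x X) *: x - ip x x *: X - tp x x X.
Proof. by rewrite !jt_def (ipC X x); vec_ring. Qed.

Lemma tp_tp x X Y : tp (tp X X x) x Y = ip x x *: tp X X Y.
Proof.
apply/rowP => k; have := congr1 (fun v : V => v 0 k) (tp_anticomm2 X X x x Y).
by rewrite (tpC x) !rowE; lra.
Qed.

(** For $T = T(X,X,\cdot)$, [tp_jt] gives the difference of $\{Tx,x,Y\}$ and $\{x,Tx,Y\}$, and
    [jt_sym] their sum. *)
Lemma jt_tp_l x X Y : 2 *: jt (tp X X x) x Y =
  2^-1 *: (tp X X (tp x x Y) - tp x x (tp X X Y)) + (3 * ip (tp X X x) x) *: Y
  + ip x x *: tp X X Y.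
Proof.
have E1 := tp_jt X X x x Y.
have E2 := jt_sym (tp X X x) x Y.
rewrite tp_tp in E2.
rewrite !jt_diag !tpE in E1.
apply/rowP => k; move: (congr1 (fun v : V => v 0 k) E1).
by move: (congr1 (fun v : V => v 0 k) E2); rewrite !rowE; lra.
Qed.

Lemma jt_tp_m x X Y : 2 *: jt X (tp x x X) Y =
  2^-1 *: (tp X X (tp x x Y) - tp x x (tp X X Y)) + (3 * ip (tp x x X) X) *: Y
  + ip X X *: tp x x Y.
Proof.
have E1 := tp_jt x x X X Y.
have E2 := jt_sym (tp x x X) X Y.
rewrite tp_tp in E2.
rewrite !jt_diag !tpE in E1.
apply/rowP => k; move: (congr1 (fun v : V => v 0 k) E1).
by move: (congr1 (fun v : V => v 0 k) E2); rewrite !rowE; lra.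
Qed.

(* The Jordan identity D({X,x,X},x) = D(X,{x,X,x}) where D(a,b) = {a,b,.}. *)
Lemma jt_shift x X Y : jt (jt X x X) x Y = jt X (jt x X x) Y.
Proof.
have E1 := jt_tp_l x X Y; have E2 := jt_tp_m x X Y.
rewrite !jt_outer !jtE !jt_diag (ipC X x) (tp_ip X X x x) in E1 E2 *.
apply/rowP => k; move: (congr1 (fun v : V => v 0 k) E1).
by move: (congr1 (fun v : V => v 0 k) E2); rewrite !rowE; lra.
Qed.

Lemma jt_shift_lin x X W Y :
  2 *: jt (jt X x W) x Y = jt X (jt x W x) Y + jt W (jt x X x) Y.
Proof.
have := jt_shift x (X + W) Y; rewrite !jtE !jt_shift (jtC W x X) => E.
apply/rowP => k; move: (congr1 (fun v : V => v 0 k) E).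
by rewrite !rowE; lra.
Qed.

(** * The projection onto an octonionic line and its structural operators *)

Lemma bop_def x Y : bop x Y = 2^-1 *: (ip x x *: Y + tp x x Y).
Proof. by rewrite bop.unlock. Qed.

Lemma bopD x Y Z : bop x (Y + Z) = bop x Y + bop x Z.
Proof. by rewrite !bop_def tpDr; vec_ring. Qed.

Lemma bopZ x a Y : bop x (a *: Y) = a *: bop x Y.
Proof. by rewrite !bop_def tpZr; vec_ring. Qed.

Lemma bopN x Y : bop x (- Y) = - bop x Y.
Proof. by rewrite -scaleN1r bopZ scaleN1r. Qed.

Definition bopE := (bopD, bopZ, bopN).

Lemma bop_adj x Y Z : ip (bop x Y) Z = ip Y (bop x Z).
Proof. by rewrite !bop_def !ipE tp_adj; ring. Qed.

Lemma tpK x Y : tp x x (tp x x Y) = (ip x x ^+ 2) *: Y.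
Proof.
have := tp_anticomm x x x x Y; rewrite tp_diag ipZl => E; apply/rowP => k.
by move: (congr1 (fun v : V => v 0 k) E); rewrite !rowE; lra.
Qed.

Lemma bop_idem x Y : bop x (bop x Y) = ip x x *: bop x Y.
Proof. by rewrite !bop_def !tpE tpK; apply/rowP => k; rewrite !rowE; field. Qed.

Lemma bop_self x : bop x x = ip x x *: x.
Proof. by rewrite bop_def tp_diag; apply/rowP => k; rewrite !rowE; field. Qed.

(** The identity obeys the same rule as [tp x x], since $1 - 1 + 1 = 1$. *)
Lemma bop_jt x X y Z :
  bop x (jt X y Z) = jt (bop x X) y Z - jt X (bop x y) Z + jt X y (bop x Z).
Proof. by rewrite !bop_def tp_jt !jtE; vec_ring. Qed.

(** Apply [bop_jt] twice and compare with [bop_idem]. *)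
Lemma bop_jt_bop x X y Z : bop x (jt X (bop x y) Z) = jt (bop x X) y (bop x Z).
Proof.
have := bop_idem x (jt X y Z).
rewrite !bop_jt !bopE !bop_jt !bop_idem !jtE => E; apply/rowP => k.
by move: (congr1 (fun v : V => v 0 k) E); rewrite !rowE; lra.
Qed.

(** The coefficient of $s^2$ is trivial, that of $st$ is [bop_jt], that of $t^2$ is [bop_jt_bop]. *)
Lemma jt_structural x s t X y Z :
  let L Y := s *: Y + t *: bop x Y in L (jt X (L y) Z) = jt (L X) y (L Z).
Proof.
by move=> L; rewrite /L !jtE !bopE bop_jt_bop bop_jt; vec_ring.
Qed.

Lemma jt_outer_bop x X : jt x X x = (4 * ip x X) *: x - 2 *: bop x X.
Proof. by rewrite jt_outer bop_def; apply/rowP => k; rewrite !rowE; field. Qed.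

(** The left side collects the $D^{-2}$ terms of the curvature: products of Christoffel tensors and
    the derivative of $1/D$. *)
Lemma jt_curvature x X Y :
  jt Y x (jt X x X) - jt X x (jt Y x X)
  + (2 * ip x Y) *: jt X x X - (2 * ip x X) *: jt Y x X
  = jt X (bop x Y) X - jt X (bop x X) Y.
Proof.
have Ea : jt Y x (jt X x X) = (4 * ip x X) *: jt X x Y - 2 *: jt X (bop x X) Y.
  by rewrite jtC jt_shift jt_outer_bop !jtE.
have Eb : 2 *: jt X x (jt Y x X) = (4 * ip x Y) *: jt X x X
    - 2 *: jt X (bop x Y) X + (4 * ip x X) *: jt X x Y - 2 *: jt X (bop x X) Y.
  rewrite jtC (jtC Y x X) jt_shift_lin (jtC Y (jt _ _ _)) !(jt_outer_bop x) !jtE.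
  by vec_ring.
rewrite Ea (jtC Y x X); apply/rowP => k.
by move: (congr1 (fun v : V => v 0 k) Eb); rewrite (jtC Y x X) !rowE; lra.
Qed.

(* The Jacobi operator at the origin. *)
Definition jac0 X Y :=
  (5 / 2 * ip X X) *: Y - (4 * ip X Y) *: X + (3 / 2) *: tp X X Y.

Lemma jt_jac0 X Y : jt X X Y - jt X Y X = jac0 X Y.
Proof. by rewrite jt_diag jt_outer /jac0; apply/rowP => k; rewrite !rowE; field. Qed.

Lemma ip_jac0 X Y : ip X (jac0 X Y) = 0.
Proof. by rewrite /jac0 !ipE -tp_adj tp_diag !ipE; field. Qed.

(** Here $4 = 5/2 + 3/2$. Orthogonality to [X] follows from the eigenvalue equation: the image of
    [jac0 X] is orthogonal to [X] and the eigenvalue is nonzero. *)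
Lemma jac0_eig4 X Y : ip X X != 0 ->
  jac0 X Y = (ip X X * 4) *: Y <-> tp X X Y = ip X X *: Y /\ ip X Y = 0.
Proof.
move=> nzX; split=> [E | [E1 E2]].
  have XY0 : ip X Y = 0.
    have := ip_jac0 X Y; rewrite E ipZr => /eqP.
    by rewrite !mulf_eq0 (negPf nzX) /= pnatr_eq0 /= => /eqP.
  split=> //; apply/rowP => k; move: (congr1 (fun v : V => v 0 k) E).
  by rewrite /jac0 XY0 !rowE; lra.
by rewrite /jac0 E1 E2; apply/rowP => k; rewrite !rowE; field.
Qed.

Lemma jac0_eig1 X Y : ip X X != 0 ->
  jac0 X Y = (ip X X * 1) *: Y <-> tp X X Y = - (ip X X) *: Y /\ ip X Y = 0.
Proof.
move=> nzX; split=> [E | [E1 E2]].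
  have XY0 : ip X Y = 0.
    have := ip_jac0 X Y; rewrite E ipZr => /eqP.
    by rewrite !mulf_eq0 (negPf nzX) /= oner_eq0 /= => /eqP.
  split=> //; apply/rowP => k; move: (congr1 (fun v : V => v 0 k) E).
  by rewrite /jac0 XY0 !rowE; lra.
by rewrite /jac0 E1 E2; apply/rowP => k; rewrite !rowE; field.
Qed.

(** For an eigenvector [Y] the two terms of [tp_anticomm2] coincide. *)
Lemma tp_line X Y Z c : tp X X Y = c *: Y ->
  c *: tp Y Y Z = ip Y Y *: tp X X Z.
Proof.
move=> E; have := tp_anticomm2 X X Y Y Z; rewrite E tpZl tpZm => {}E.
apply/rowP => k; move: (congr1 (fun v : V => v 0 k) E).
by rewrite !rowE; lra.
Qed.

(** * Existence of eigenvectors *)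

Lemma cliff_adj r c x y : ip (cliff r c x) y = ip x (cliff r c y).
Proof.
by elim/octpair_ind: x => p q; elim/octpair_ind: y => p' q'; oct_ring.
Qed.

Lemma cliff_anticomm_orth r c r' c' z : r * r' - oinner c c' = 0 ->
  cliff r c (cliff r' c' z) = - cliff r' c' (cliff r c z).
Proof.
move=> E; have := cliff_anticomm r c r' c' z; rewrite E mulr0 scale0r.
by move/eqP; rewrite addr_eq0 => /eqP.
Qed.

Lemma cliff_eq0 c z : oinner c c != 0 -> cliff 0 c z = 0 -> z = 0.
Proof.
move=> nzc E; have := cliff_anticomm 0 c 0 c z.
have cliff0 : cliff 0 c 0 = 0 by have := cliffZ 0 c 0 (0 : V); rewrite !scale0r.
rewrite E !cliff0 addr0 => /esym/eqP; rewrite scaler_eq0 => /orP[|/eqP //].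
by rewrite mul0r sub0r mulf_eq0 oppr_eq0 (negPf nzc) pnatr_eq0.
Qed.

Lemma orth_plane (a b : R) : exists s t, s * a + t * b = 0 /\ s ^+ 2 + t ^+ 2 != 0.
Proof.
case: (eqVneq (a ^+ 2 + b ^+ 2) 0) => [E|nz].
  exists 1, 0; move: E => /eqP; rewrite paddr_eq0 ?sqr_ge0 // !sqrf_eq0.
  case/andP => /eqP-> /eqP->.
  by rewrite mulr0 mulr0 addr0 expr1n expr0n addr0 oner_eq0.
by exists b, (- a); split; [ring | rewrite sqrrN addrC].
Qed.

(* Multiplication by a Clifford vector orthogonal to the moment of [X]
   anticommutes with [tp X X]: one such factor gives the second eigenvector, two
   orthogonal ones give the first. *)
Lemma tp_eigvec X : X != 0 ->
  (exists Y, [/\ Y != 0, tp X X Y = ip X X *: Y & ip X Y = 0])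
  /\ (exists Y, Y != 0 /\ tp X X Y = - (ip X X) *: Y).
Proof.
move=> nzX; set p := beta1 X X.
(* Taking [c] and [c'] in two different coordinate planes makes them orthogonal to each other as
   well as to [p]. *)
have [s [t [orth_c nz_c]]] := orth_plane (qre (o1 p)) (qi (o1 p)).
have [s' [t' [orth_c' nz_c']]] := orth_plane (qj (o1 p)) (qk (o1 p)).
pose c : oct R := Oct (Quat s t 0 0) (Quat 0 0 0 0).
pose c' : oct R := Oct (Quat 0 0 s' t') (Quat 0 0 0 0).
have cc : oinner c c != 0.
  by rewrite (_ : oinner c c = s ^+ 2 + t ^+ 2) //; rewrite /c; oct_ring.
have cc' : oinner c' c' != 0.
  by rewrite (_ : oinner c' c' = s' ^+ 2 + t' ^+ 2) //; rewrite /c'; oct_ring.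
have pc : oinner p c = 0.
  rewrite -[RHS]orth_c /c; move: p {orth_c orth_c'} => p; oct_ring.
have pc' : oinner p c' = 0.
  rewrite -[RHS]orth_c' /c'; move: p {orth_c orth_c' pc} => p; oct_ring.
have c_c' : oinner c c' = 0 by rewrite /c /c'; oct_ring.
have Tc Z : tp X X (cliff 0 c Z) = - cliff 0 c (tp X X Z).
  by apply: cliff_anticomm_orth; rewrite pc mulr0 subr0.
have Tc' Z : tp X X (cliff 0 c' Z) = - cliff 0 c' (tp X X Z).
  by apply: cliff_anticomm_orth; rewrite pc' mulr0 subr0.
have cliffN d Z : cliff 0 d (- Z) = - cliff 0 d Z :> V.
  by rewrite -scaleN1r cliffZ scaleN1r.
split.
  exists (cliff 0 c (cliff 0 c' X)); split.
  - by apply: contra_neq nzX => /(cliff_eq0 cc)/(cliff_eq0 cc').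
  - by rewrite Tc Tc' tp_diag cliffN opprK !cliffZ.
  (* Self-adjointness makes this product symmetric in [c, c'], anticommutation makes it
     antisymmetric; so it vanishes. *)
  have E : ip X (cliff 0 c (cliff 0 c' X)) = ip X (cliff 0 c' (cliff 0 c X)).
    by rewrite -[LHS]cliff_adj [LHS]ipC [LHS]cliff_adj.
  have := E; rewrite {1}(@cliff_anticomm_orth 0 c 0 c') ?c_c' ?mulr0 ?subr0 //.
  by rewrite ipNr; move: E => ->; lra.
exists (cliff 0 c X); split; first by apply: contra_neq nzX => /(cliff_eq0 cc).
by rewrite Tc tp_diag cliffZ scaleNr.
Qed.

(** * The metric of the plane and its curvature *)

Definition gnum x X Y := den x * ip X Y - ip (bop x X) Y.

Lemma metric_gnum x X Y : OP11_metric x X Y = gnum x X Y / den x / den x.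
Proof.
rewrite /OP11_metric !quad_tp -/(den x) /gnum bop_def -mulrA -invfM -expr2.
rewrite !(ipE, tpE) (tp_adj x x Y X) (ipC Y (tp x x X)) (ipC Y X).
by move: ((den x ^+ 2)^-1) => i; field.
Qed.

Lemma is_derive_den x v : is_derive x v (@den R) (2 * ip x v).
Proof.
apply: (is_derive_quadratic (b := ip v v)) => h.
by rewrite /den !ipE (ipC v x); ring.
Qed.

Lemma is_derive_gnum x v X Y :
  is_derive x v (fun y => gnum y X Y) (ip x v * ip X Y - ip (tp x v X) Y).
Proof.
apply: (is_derive_quadratic (b := ip v v * ip X Y - ip (bop v X) Y)) => h.
by rewrite /gnum /den !bop_def !(ipE, tpE) (ipC v x) (tpC v x); field.
Qed.

Definition dmetric x Z X Y :=
  (ip x Z * ip X Y - ip (tp x Z X) Y) / den x ^+ 2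
  - 4 * ip x Z * gnum x X Y / den x ^+ 3.

Lemma is_derive_metric x Z X Y : den x != 0 ->
  is_derive x Z (fun y => OP11_metric y X Y) (dmetric x Z X Y).
Proof.
move=> nzD.
have -> : (fun y => OP11_metric y X Y) = (fun y => gnum y X Y / den y / den y).
  by apply/funext => y; rewrite metric_gnum.
have dN := is_derive_gnum x Z X Y; have dD := is_derive_den x Z.
apply: is_derive_eq (is_derive_quot nzD (is_derive_quot nzD dN dD) dD) _.
by rewrite /dmetric; field.
Qed.

Lemma gop_def x Y : gop x Y = (den x)^-1 *: Y - (den x) ^- 2 *: bop x Y.
Proof. by rewrite gop.unlock. Qed.

Lemma gopD x Y Z : gop x (Y + Z) = gop x Y + gop x Z.
Proof. by rewrite !gop_def bopE; apply/rowP => k; rewrite !rowE; ring. Qed.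

Lemma gopZ x a Y : gop x (a *: Y) = a *: gop x Y.
Proof. by rewrite !gop_def bopE; apply/rowP => k; rewrite !rowE; ring. Qed.

Lemma metric_gop x X Y : den x != 0 -> OP11_metric x X Y = ip (gop x X) Y.
Proof.
by move=> nzD; rewrite metric_gnum gop_def /gnum !ipE; field.
Qed.

(** The inverse of [gop x]. As [bop x] satisfies $B^2 = (D-1)B$, this is $D$ where $B = 0$ and $D^2$
    where $B = D-1$. *)
Definition gopV x Y := den x *: (Y + bop x Y).

Lemma gopK x Y : den x != 0 -> gopV x (gop x Y) = Y.
Proof.
move=> nzD; rewrite /gopV gop_def !bopE bop_idem.
have -> : ip x x = den x - 1 by rewrite /den; ring.
by vec_ring.
Qed.

Lemma gopVK x Y : den x != 0 -> gop x (gopV x Y) = Y.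
Proof.
move=> nzD; rewrite /gopV gop_def !bopE bop_idem.
have -> : ip x x = den x - 1 by rewrite /den; ring.
by vec_ring.
Qed.

Lemma bop_jt_self x X Y : bop x (jt X x Y) =
  (2 * ip X x) *: bop x Y + (2 * ip x Y) *: bop x X - (2 * ip (bop x X) Y) *: x.
Proof.
(* Anticommuting [tp x x] with [tp X Y] at [x] cancels the two multiples of [tp X Y x]. *)
have E : bop x (tp X Y x) = ip (tp x x X) Y *: x.
  have := tp_anticomm x x X Y x; rewrite tp_diag tpZr bop_def => E.
  apply/rowP => k; move: (congr1 (fun v : V => v 0 k) E).
  by rewrite !rowE; lra.
rewrite jt_def !bopE E bop_self (bop_def x X) !ipE.
by vec_ring.
Qed.

(** The Koszul formula: the Fierz identity eliminates [tp x X Y], leaving the terms that occur in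
    [dmetric]. *)
Lemma dmetric_jt x X Y Z : den x != 0 ->
  2 * ip (gop x (- (den x)^-1 *: jt X x Y)) Z =
  dmetric x X Y Z + dmetric x Y X Z - dmetric x Z X Y.
Proof.
move=> nzD; rewrite gop_def !(bopE, ipE) bop_jt_self jt_def !ipE.
have := congr1 (fun v : V => ip v Z) (tp_fierz x X Y); rewrite !ipE => E.
have {}E : ip (tp x X Y) Z = ip x X * ip Y Z + ip X Y * ip x Z + ip Y x * ip X Z
    - ip (tp X Y x) Z - ip (tp x Y X) Z by rewrite (tpC x Y X) -E; ring.
rewrite /dmetric E (tp_ip x Z X) (ipC X x) (ipC Y x) /gnum.
have -> : ip (tp X Y x) Z = ip (tp x Z X) Y by rewrite tp_ip.
by field.
Qed.

(** A vector in the kernel is killed by [gop x], which [gopV x] inverts. *)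
Lemma gmx_unit x : den x != 0 -> gmx (@OP11_metric R) x \in unitmx.
Proof.
move=> nzD; rewrite -row_free_unit; apply: inj_row_free => v v0.
rewrite -(gopK v nzD); suff -> : gop x v = 0.
  by have := bopZ x 0 0; rewrite /gopV !scale0r => ->; rewrite addr0 scaler0.
apply: ip_nondeg => z; have := ipZl 0 0 z; rewrite scale0r mul0r => ->.
rewrite (linear_evecE (f := ip (gop x v))); last by move=> a X Y; rewrite !ipE.
apply: big1 => l _; have := congr1 (fun u : V => u 0 l) v0; rewrite !mxE.
under eq_bigr do rewrite mxE metric_gop //.
rewrite -(linear_evecE (f := fun X => ip (gop x X) (evec R l))).
  by move=> ->; rewrite mulr0.
by move=> a X Y; rewrite gopD gopZ !ipE.
Qed.

Lemma christoffel_OP11 x k i j : den x != 0 ->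
  christoffel (@OP11_metric R) k i j x
  = (- (den x)^-1 *: jt (evec R i) x (evec R j)) 0 k.
Proof.
move=> nzD; apply: christoffelE; first exact: gmx_unit.
  apply/matrixP => a b; rewrite !mxE !metric_gop // !gop_def !ipE bop_adj.
  by rewrite (ipC (evec R b)) (ipC (evec R b)).
move=> l.
have pdE a b c : pd a (fun y => gmx (@OP11_metric R) y b c) x
    = dmetric x (evec R a) (evec R b) (evec R c).
  rewrite /pd -[RHS](@derive_val _ _ _ _ _ _ _
    (is_derive_metric (evec R a) (evec R b) (evec R c) nzD)).
  by congr ('D_ _ _ x); apply/funext => y; rewrite mxE.
rewrite !pdE -dmetric_jt //; congr (_ * _); rewrite mxE.
under eq_bigr do rewrite [gmx _ _ _ _]mxE metric_gop //.
rewrite -(linear_evecE (f := fun X => ip (gop x X) (evec R l))) //.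
by move=> a X Y; rewrite gopD gopZ !ipE.
Qed.

Lemma continuous_den : continuous (@den R).
Proof.
have -> : @den R = fun y : V =>
    1 + \sum_i y 0 i * \sum_j y 0 j * ip (evec R i) (evec R j).
  apply/funext => y; rewrite /den; congr (1 + _).
  rewrite {1}(linear_evecE (f := fun X : V => ip X y)); last first.
    by move=> a X Y; rewrite !ipE.
  apply: eq_bigr => i _; congr (_ * _).
  by rewrite (linear_evecE (f := ip _)) // => a X Y; rewrite !ipE.
have cts_coord i : continuous (fun y : V => y 0 i) by exact: coord_continuous.
have cts_j i : continuous (fun y : V => \sum_j y 0 j * ip (evec R i) (evec R j)).
  apply: continuous_big => [|j _]; first exact: add_continuous.
  by move=> y; apply: (@cvgM _ _ (nbhs y) _ (fun y : V => y 0 j)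
    (cst (ip (evec R i) (evec R j)))); [exact: cts_coord | exact: cvg_cst].
have cts_i : continuous (fun y : V =>
    \sum_i y 0 i * \sum_j y 0 j * ip (evec R i) (evec R j)).
  apply: continuous_big => [|i _]; first exact: add_continuous.
  by move=> y; apply: (@cvgM _ _ (nbhs y) _ (fun y : V => y 0 i));
    [exact: cts_coord | exact: cts_j].
move=> y.
have cts_1 : continuous (fun _ : V => 1 : R) by exact: cst_continuous.
exact: (cvgD (cts_1 y) (cts_i y)).
Qed.

Lemma near_den x : den x != 0 -> \forall y \near x, den y != 0.
Proof. exact: cvgr_neq0 (den x) (continuous_den (x := x)). Qed.

(** The $D^{-1}$ terms of the curvature give the identity part of [gop]; by [jt_curvature] the
    $D^{-2}$ terms give its [bop] part. *)
Lemma jacobi_OP11 x X Y : den x != 0 ->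
  jacobi (@OP11_metric R) x X Y = jt X (gop x X) Y - jt X (gop x Y) X.
Proof.
move=> nzD.
pose G y X Z : V := - (den y)^-1 *: jt X y Z.
pose dG W X Z : V := - (den x)^-1 *: jt X W Z
  + (2 * ip x W / den x ^+ 2) *: jt X x Z.
rewrite /jacobi.
have -> : curv (@OP11_metric R) x X Y X =
    dG Y X X - dG X Y X + (G x Y (G x X X) - G x X (G x Y X)).
  apply: curvE.
  - near=> y => k i j; apply: christoffel_OP11.
    by near: y; exact: near_den.
  - move=> k l i j.
    have dN : is_derive x (evec R l) (fun y => - jt (evec R i) y (evec R j) 0 k)
        (- jt (evec R i) (evec R l) (evec R j) 0 k).
      by apply: (is_derive_quadratic (b := 0)) => h; rewrite !jtE !rowE; ring.
    have dD := is_derive_den x (evec R l).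
    have -> : (fun y => G y (evec R i) (evec R j) 0 k) =
        (fun y => - jt (evec R i) y (evec R j) 0 k / den y).
      by apply/funext => y; rewrite /G rowE mulNr mulrC mulNr.
    apply: is_derive_eq (is_derive_quot nzD dN dD) _.
    by rewrite /dG !rowE; field.
  - by move=> a X1 X2 Z; rewrite /G !jtE; vec_ring.
  - by move=> a X1 X2 Z; rewrite /G !jtE; vec_ring.
  - by move=> a X1 X2 Z W; rewrite /dG !(jtE, ipE); vec_ring.
  - by move=> a X1 X2 Z W; rewrite /dG !(jtE, ipE); vec_ring.
  - by move=> a X1 X2 Z W; rewrite /dG !(jtE, ipE); vec_ring.
rewrite /G /dG !gop_def !jtE.
apply/rowP => k; move: (congr1 (fun v : V => v 0 k) (jt_curvature x X Y)).
rewrite !rowE (jtC Y X X) => E.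
have -> : jt X (bop x X) Y 0 k = jt X (bop x Y) X 0 k
    - (jt X (bop x Y) X 0 k - jt X (bop x X) Y 0 k) by ring.
by rewrite -E; field.
Unshelve. all: by end_near. Qed.

(** * The square root of the metric operator *)

Lemma rop_def x Y : rop x Y = (Num.sqrt (den x))^-1 *: Y
  + - (Num.sqrt (den x) ^+ 2 * (1 + Num.sqrt (den x)))^-1 *: bop x Y.
Proof. by rewrite rop.unlock. Qed.

Lemma ropD x Y Z : rop x (Y + Z) = rop x Y + rop x Z.
Proof. by rewrite !rop_def bopE; apply/rowP => k; rewrite !rowE; ring. Qed.

Lemma ropZ x a Y : rop x (a *: Y) = a *: rop x Y.
Proof. by rewrite !rop_def bopE; apply/rowP => k; rewrite !rowE; ring. Qed.

Lemma ropN x Y : rop x (- Y) = - rop x Y.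
Proof. by rewrite -scaleN1r ropZ scaleN1r. Qed.

Lemma rop0 x : rop x 0 = 0.
Proof. by have := ropZ x 0 0; rewrite !scale0r. Qed.

Definition ropE := (ropD, ropZ, ropN).

Lemma rop_adj x Y Z : ip (rop x Y) Z = ip Y (rop x Z).
Proof. by rewrite !rop_def !ipE bop_adj. Qed.

Lemma rop_jt x X y Z : rop x (jt X (rop x y) Z) = jt (rop x X) y (rop x Z).
Proof. by rewrite !rop_def; exact: jt_structural. Qed.

Lemma ropK2 x Y : 0 < den x -> rop x (rop x Y) = gop x Y.
Proof.
move=> D_gt0; have s_gt0 : 0 < Num.sqrt (den x) by rewrite sqrtr_gt0.
have sE : den x = Num.sqrt (den x) ^+ 2 by rewrite sqr_sqrtr // ltW.
rewrite !rop_def gop_def !bopE bop_idem.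
have -> : ip x x = den x - 1 by rewrite /den; ring.
move: (Num.sqrt (den x)) sE s_gt0 => s sE s_gt0; rewrite sE.
have nzs : s != 0 by rewrite gt_eqF.
have nzs1 : 1 + s != 0 by rewrite gt_eqF // addr_gt0.
by apply/rowP => k; rewrite !rowE; field; rewrite nzs nzs1.
Qed.

(** * The Osserman conditions *)

Section Osserman.
Variable x : V.
Hypothesis D_gt0 : 0 < den x.
Notation r := (rop x).

Let nzD : den x != 0. Proof. by rewrite gt_eqF. Qed.

Lemma metric_rop X Y : OP11_metric x X Y = ip (r X) (r Y).
Proof. by rewrite metric_gop // -ropK2 // rop_adj. Qed.

Lemma rop_inj : injective r.
Proof.
move=> X Y /(congr1 r); rewrite !(ropK2 _ D_gt0) => /(congr1 (gopV x)).
by rewrite !(gopK _ nzD).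
Qed.

Lemma rop_surj Y : exists X, r X = Y.
Proof. by exists (r (gopV x Y)); rewrite ropK2 // gopVK. Qed.

Lemma rop_jacobi X Y : r (jacobi (@OP11_metric R) x X Y) = jac0 (r X) (r Y).
Proof.
(* Once [gop] is split as [rop] twice, [rop_jt] absorbs the outer [rop] and one of the inner two. *)
rewrite (jacobi_OP11 _ _ nzD) ropD ropN -(ropK2 X D_gt0) -(ropK2 Y D_gt0).
by rewrite !rop_jt jt_jac0.
Qed.

Lemma in_eig_jac0 X c Y : in_eig (@OP11_metric R) x X c Y <->
  jac0 (r X) (r Y) = (ip (r X) (r X) * c) *: r Y.
Proof.
rewrite /in_eig /epsv metric_rop -rop_jacobi -ropZ.
by split=> [-> //|]; exact: rop_inj.
Qed.

Lemma unit_vec_neq0 X : unit_vec (@OP11_metric R) x X -> ip (r X) (r X) != 0.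
Proof.
by rewrite /unit_vec metric_rop => -[] ->; rewrite ?oppr_eq0 oner_eq0.
Qed.

(** By [tp_diag], [r X] lies in the same eigenspace of [tp (r X) (r X)] as the images of the
    4-eigenvectors; adding the span of [X] thus fills that eigenspace. *)
Lemma Espace_tp X Y : ip (r X) (r X) != 0 ->
  Espace (@OP11_metric R) x X 4 Y <-> tp (r X) (r X) (r Y) = ip (r X) (r X) *: r Y.
Proof.
move=> nzX; split=> [[t [Z [-> /in_eig_jac0/(jac0_eig4 _ nzX) [ZE _]]]]|YE].
  by rewrite ropD ropZ tpDr tpZr ZE tp_diag; vec_ring.
exists (ip (r X) (r Y) / ip (r X) (r X)).
exists (Y - (ip (r X) (r Y) / ip (r X) (r X)) *: X).
split; first by rewrite addrC subrK.
apply/in_eig_jac0/(jac0_eig4 _ nzX); rewrite !ropE !(tpE, ipE) YE tp_diag.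
by split; [vec_ring | field].
Qed.

Lemma cond_I_OP11 X : unit_vec (@OP11_metric R) x X ->
  cond_I (@OP11_metric R) x X 4 1.
Proof.
move=> /unit_vec_neq0 nzX; rewrite /cond_I /orth.
have nzrX : r X != 0.
  by apply: contra_neq nzX => ->; rewrite -(scale0r 0) ipZl mul0r.
split; last split.
- move=> W; rewrite metric_rop => XW.
  have TW : ip (r X) (tp (r X) (r X) (r W)) = 0.
    by rewrite -tp_adj tp_diag ipZl XW mulr0.
  (* By [tpK], [e] times [tp (r X) (r X)] is an involution; [A] and [B] come from its two spectral
     projections. *)
  pose e := (ip (r X) (r X))^-1.
  have [A AE] := rop_surj (2^-1 *: (r W + e *: tp (r X) (r X) (r W))).
  have [B BE] := rop_surj (2^-1 *: (r W - e *: tp (r X) (r X) (r W))).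
  exists A, B; rewrite !metric_rop.
  have XA : ip (r X) (r A) = 0 by rewrite AE !ipE XW TW; ring.
  have XB : ip (r X) (r B) = 0 by rewrite BE !ipE XW TW; ring.
  split=> //; split=> //; split; [|split].
  + apply/in_eig_jac0/(jac0_eig4 _ nzX); split=> //.
    by rewrite AE !tpE tpK /e; vec_ring.
  + apply/in_eig_jac0/(jac0_eig1 _ nzX); split=> //.
    by rewrite BE !tpE tpK /e; vec_ring.
  by apply: rop_inj; rewrite ropD AE BE; vec_ring.
- have [[Y [nzY YE XY]] _] := tp_eigvec nzrX; have [A AE] := rop_surj Y.
  exists A; rewrite metric_rop AE; split; last split=> //.
    by apply: contra_neq nzY => A0; rewrite -AE A0 rop0.
  by apply/in_eig_jac0/(jac0_eig4 _ nzX); rewrite AE.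
have [_ [Y [nzY YE]]] := tp_eigvec nzrX; have [B BE] := rop_surj Y.
have XY : ip (r X) Y = 0.
  (* Eigenvectors of a self-adjoint operator for opposite nonzero eigenvalues are orthogonal. *)
  have := tp_adj (r X) (r X) (r X) Y; rewrite YE tp_diag ipZl ipZr => E.
  have /eqP : ip (r X) (r X) * ip (r X) Y = 0 by lra.
  by rewrite mulf_eq0 (negPf nzX) => /eqP.
exists B; rewrite metric_rop BE; split; last split=> //.
  by apply: contra_neq nzY => B0; rewrite -BE B0 rop0.
by apply/in_eig_jac0/(jac0_eig1 _ nzX); rewrite BE.
Qed.

Lemma cond_II_OP11 X : unit_vec (@OP11_metric R) x X ->
  cond_II (@OP11_metric R) x X 4.
Proof.
move=> /unit_vec_neq0 nzX W /unit_vec_neq0 nzW /(Espace_tp _ nzX) WE Z.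
(* [tp (r W) (r W)] and [tp (r X) (r X)], divided by the respective norms, are the same operator, so
   their eigenspaces agree. *)
have E := tp_line (r Z) WE.
apply: (iff_trans (Espace_tp _ nzW)); apply: iff_sym.
apply: (iff_trans (Espace_tp _ nzX)); split=> ZE; rewrite ZE in E.
  by apply: (scalerI nzX); rewrite E !scalerA mulrC.
by apply: (scalerI nzW); rewrite -E !scalerA mulrC.
Qed.

Lemma cond_III_OP11 X : unit_vec (@OP11_metric R) x X ->
  cond_III (@OP11_metric R) x X 1.
Proof.
move=> /unit_vec_neq0 nzX W /unit_vec_neq0 nzW.
move=> /in_eig_jac0/(jac0_eig1 _ nzX) [WE XW].
(* Evaluated at [r X] itself, the proportionality shows that [r X] is an eigenvector of
   [tp (r W) (r W)]. *)
have := tp_line (r X) WE; rewrite tp_diag => E.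
apply/in_eig_jac0/(jac0_eig1 _ nzW); rewrite ipC; split=> //.
have nzX' : - ip (r X) (r X) != 0 by rewrite oppr_eq0.
by apply: (scalerI nzX'); rewrite E !scalerA mulrNN mulrC.
Qed.

End Osserman.

End Plane.

(* OP^(1,1) is covered by the two charts U1, U2, on which the metric has the
   same coordinate expression OP11_metric; the manifold is special Osserman
   (with global constants lam, mu) iff the conditions hold at every point of
   either chart. *)
Theorem theorem9p4 (R : realType) :
  special_osserman (@OP11_metric R) (fun x => U1_dom x \/ U2_dom x).
Proof.
exists 4, 1; split; first by rewrite pnatr_eq1.
split; first by rewrite pnatr_eq0.
split; first by rewrite oner_eq0.
move=> x Dx X uX.
(* Both chart domains are given by this same inequality. *)
have D_gt0 : 0 < den x.
  by case: Dx; rewrite /U1_dom /U2_dom /den /ip /onorm2; lra.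
by split; [exact: cond_I_OP11 | split; [exact: cond_II_OP11 | exact: cond_III_OP11]].
Qed.
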